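(* Let $n\ge 3$, let $(\mathcal{L},[\cdot,\dots,\cdot],\alpha,\epsilon)$ be a centerless perfect multiplicative $n$-Hom-Lie color algebra, and let $D\in\mathcal{D}_{\alpha^k}(\mathcal{L})$ be a double $\alpha^k$-derivation of degree $d$. Then: (1) $\delta_D$ is a double derivation of $\mathcal{L}$. (2) For all $x_1,\dots,x_n\in\mathcal{H}(\mathcal{L})$ and every $i=1,\dots,n$, $$(D-\delta_D)([x_1,\dots,x_n])=-\epsilon(d,X_i)[\alpha^k(x_1),\dots,(D-\delta_D)(x_i),\dots,\alpha^k(x_n)],$$ where $X_i=x_1+\dots+x_{i-1}$. (3) $\delta_{D-\delta_D}=-n(D-\delta_D)$.
   Context: Let $\mathbb{K}$ be a field, $G$ an additive abelian group, and $\epsilon:G\times G\to\mathbb{K}\setminus\{0\}$ a skew-symmetric bicharacter: $\epsilon(g,h)\epsilon(h,g)=1$, $\epsilon(g+h,k)=\epsilon(g,k)\epsilon(h,k)$, $\epsilon(g,h+k)=\epsilon(g,h)\epsilon(g,k)$. For a $G$-graded space $V$, $\mathcal{H}(V)$ is the set of homogeneous elements; inside $\epsilon$, a homogeneous element stands for its degree and a sum of homogeneous elements stands for the sum of their degrees. A linear map $f$ is homogeneous of degree $\theta$ if $f(V_g)\subset V_{g+\theta}$ for all $g\in G$, and even if $\theta=0$. An $n$-Hom-Lie color algebra is a $G$-graded space $\mathcal{L}=\bigoplus_{g\in G}\mathcal{L}_g$ with an $n$-linear bracket $[\cdot,\dots,\cdot]$ compatible with the grading, the bicharacter $\epsilon$,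 and an even linear map $\alpha:\mathcal{L}\to\mathcal{L}$ such that for all homogeneous $x_i,y_j$: (i) $[x_1,\dots,x_i,x_{i+1},\dots,x_n]=-\epsilon(x_i,x_{i+1})[x_1,\dots,x_{i+1},x_i,\dots,x_n]$ for $1\le i\le n-1$; (ii) $[\alpha(x_1),\dots,\alpha(x_{n-1}),[y_1,\dots,y_n]]=\sum_{i=1}^n\epsilon(X,Y_i)[\alpha(y_1),\dots,\alpha(y_{i-1}),[x_1,\dots,x_{n-1},y_i],\alpha(y_{i+1}),\dots,\alpha(y_n)]$, with $X=x_1+\dots+x_{n-1}$, $Y_i=y_1+\dots+y_{i-1}$. It is multiplicative if $\alpha([x_1,\dots,x_n])=[\alpha(x_1),\dots,\alpha(x_n)]$. The derived algebra $\mathcal{L}^1=[\mathcal{L},\dots,\mathcal{L}]$ is the subalgebra generated by all brackets $[x_1,\dots,x_n]$; $\mathcal{L}$ is perfect if $\mathcal{L}^1=\mathcal{L}$. The center is $Z(\mathcal{L})=\{x\in\mathcal{L}:[x,\mathcal{L},\dots,\mathcal{L}]=0\}$; $\mathcal{L}$ is centerless if $Z(\mathcal{L})=0$. For $k\ge 0$, a double $\alpha^k$-derivation of degree $d$ of $\mathcal{L}$ is a linear map $D:\mathcal{L}\to\mathcal{L}$, homogeneous of degree $d\in G$, with $D\circ\alpha=\alpha\circ D$ and, for all homogeneous $x_i,y_j$, $$D([x_1,\dots,x_{n-1},[y_1,\dots,y_n]])=\sum_{i=1}^{n-1}\epsilon(d,X_i)[\alpha^k(x_1),\dots,D(x_i),\dots,\alpha^k(x_{n-1}),[\alpha^k(y_1),\dots,\alpha^k(y_n)]]$$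 $$+\sum_{j=1}^{n}\epsilon(d,X+Y_j)[\alpha^k(x_1),\dots,\alpha^k(x_{n-1}),[\alpha^k(y_1),\dots,D(y_j),\dots,\alpha^k(y_n)]],$$ where $X_i=x_1+\dots+x_{i-1}$, $X=x_1+\dots+x_{n-1}$, $Y_j=y_1+\dots+y_{j-1}$. $\mathcal{D}_{\alpha^k}(\mathcal{L})$ is the span of the double $\alpha^k$-derivations. For $\mathcal{L}$ centerless and perfect and $D\in\mathcal{D}_{\alpha^k}(\mathcal{L})$ of degree $d$, $\delta_D:\mathcal{L}\to\mathcal{L}$ is the (well-defined) linear map given on $x=\sum_{i\in I}[x_{i_1},\dots,x_{i_n}]$ ($I$ finite, $x_{i_t}$ homogeneous) by $\delta_D(x)=\sum_{i\in I}\sum_{t=1}^{n}\epsilon(d,x_{i_1}+\dots+x_{i_{t-1}})[\alpha^k(x_{i_1}),\dots,D(x_{i_t}),\dots,\alpha^k(x_{i_n})]$. In (3), $\delta_{D-\delta_D}$ is formed with the same exponent $k$. *)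

(* Defs.v *)
(* Mathematical Components. *)
From HB Require Import structures.
From mathcomp Require Import all_boot all_algebra all_fingroup.

Set Implicit Arguments.
Unset Strict Implicit.
Unset Printing Implicit Defensive.

Import GRing.Theory.
Local Open Scope ring_scope.

Section Families.
Variables (T : Type) (n : nat).

(* (x_1, ..., x_{i-1}, w, x_{i+1}, ..., x_n) *)
Definition subst_at (x : 'I_n -> T) (i : 'I_n) (w : T) : {ffun 'I_n -> T} :=
  [ffun j => if j == i then w else x j].

(* (x_1, ..., x_{n-1}, w), for n > 0: [insub] is [None] exactly at the last
   index of 'I_n. *)
Definition append (x : 'I_n.-1 -> T) (w : T) : {ffun 'I_n -> T} :=
  [ffun i : 'I_n => oapp x w (insub (val i) : option 'I_n.-1)].

End Families.

Definition bicharacter (K : fieldType) (G : zmodType) (eps : G -> G -> K) :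
    Prop :=
  [/\ forall g h, eps g h != 0,
      forall g h, eps g h * eps h g = 1,
      forall g h k, eps (g + h) k = eps g k * eps h k
    & forall g h k, eps g (h + k) = eps g h * eps g k].

(* L is the internal direct sum of the subspaces V g. *)
Definition grading (K : fieldType) (G : zmodType) (L : lmodType K)
    (V : G -> {pred L}) : Prop :=
  [/\ forall g, GRing.submod_closed (V g),
      forall x : L, exists (s : seq G) (c : G -> L),
        (forall g, c g \in V g) /\ x = \sum_(g <- s) c g
    & forall (s : seq G) (c : G -> L), uniq s -> (forall g, c g \in V g) ->
        \sum_(g <- s) c g = 0 -> forall g, g \in s -> c g = 0].

(* Homogeneous arguments come with a family of degrees: [eps] is applied to
   the degrees, and a zero argument may be given any degree. *)
Definition homogeneous_family (K : fieldType) (G : zmodType) (L : lmodType K)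
    (V : G -> {pred L}) (m : nat) (g : 'I_m -> G) (x : 'I_m -> L) : Prop :=
  forall i, x i \in V (g i).

(* X_i = x_1 + ... + x_{i-1}, on degrees *)
Definition deg_before (G : zmodType) (m : nat) (g : 'I_m -> G) (i : 'I_m) : G :=
  \sum_(j < m | (j < i)%N) g j.

Record nHomLieColor (K : fieldType) (G : zmodType) (eps : G -> G -> K)
    (n : nat) (L : lmodType K) := NHomLieColor {
  grade : G -> {pred L};
  bracket : {ffun 'I_n -> L} -> L;
  alpha : {linear L -> L};
  gradeP : grading grade;
  bracket_linear : forall (x : {ffun 'I_n -> L}) (i : 'I_n),
    linear (fun w : L => bracket (subst_at x i w));
  bracket_grade : forall (x : {ffun 'I_n -> L}) (g : 'I_n -> G),
    homogeneous_family grade g x -> bracket x \in grade (\sum_i g i);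
  alpha_even : forall (g : G) (v : L), v \in grade g -> alpha v \in grade g;
  bracket_skew : forall (x : {ffun 'I_n -> L}) (g : 'I_n -> G) (i j : 'I_n),
    homogeneous_family grade g x -> val j = (val i).+1 ->
    bracket x = - (eps (g i) (g j) *: bracket [ffun l => x (tperm i j l)]);
  hom_Jacobi : forall (x : 'I_n.-1 -> L) (gx : 'I_n.-1 -> G)
      (y : {ffun 'I_n -> L}) (gy : 'I_n -> G),
    homogeneous_family grade gx x -> homogeneous_family grade gy y ->
    bracket (append (fun i => alpha (x i)) (bracket y)) =
      \sum_(i < n) eps (\sum_j gx j) (deg_before gy i) *:
        bracket (subst_at (fun j => alpha (y j)) i (bracket (append x (y i))))
}.

Section Notions.
Variables (K : fieldType) (G : zmodType) (eps : G -> G -> K) (n : nat).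
Variables (L : lmodType K) (A : nHomLieColor eps n L).

Definition is_multiplicative : Prop :=
  forall x : {ffun 'I_n -> L},
    alpha A (bracket A x) = bracket A [ffun i => alpha A (x i)].

(* The subalgebra generated by all brackets; closure under the bracket is an
   instance of [derived_bracket]. *)
Inductive derived : L -> Prop :=
| derived_bracket (x : {ffun 'I_n -> L}) : derived (bracket A x)
| derived_zero : derived 0
| derived_add (u v : L) : derived u -> derived v -> derived (u + v)
| derived_scale (a : K) (u : L) : derived u -> derived (a *: u).

Definition perfect : Prop := forall v : L, derived v.

Definition center (v : L) : Prop :=
  forall (x : {ffun 'I_n -> L}) (i : 'I_n),
    val i = 0%N -> bracket A (subst_at x i v) = 0.

Definition centerless : Prop := forall v : L, center v -> v = 0.

Definition alphak (k : nat) : L -> L := iter k (alpha A).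

Definition double_derivation (k : nat) (d : G) (D : L -> L) : Prop :=
  [/\ linear D,
      forall (g : G) (v : L), v \in grade A g -> D v \in grade A (g + d),
      forall v : L, D (alpha A v) = alpha A (D v)
    & forall (x : 'I_n.-1 -> L) (gx : 'I_n.-1 -> G)
        (y : {ffun 'I_n -> L}) (gy : 'I_n -> G),
      homogeneous_family (grade A) gx x -> homogeneous_family (grade A) gy y ->
      D (bracket A (append x (bracket A y))) =
        \sum_(i < n.-1) eps d (deg_before gx i) *:
          bracket A (append (subst_at (fun l => alphak k (x l)) i (D (x i)))
                            (bracket A [ffun l => alphak k (y l)]))
      + \sum_(j < n) eps d (\sum_i gx i + deg_before gy j) *:
          bracket A (append (fun l => alphak k (x l))
            (bracket A (subst_at (fun l => alphak k (y l)) j (D (y j)))))].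

(* [delta] is the linear map delta_D attached to D, k and d. When L is perfect
   every vector is a sum of brackets of homogeneous elements, so at most one
   map has this property; one exists exactly when the right-hand side depends
   only on the vector represented. *)
Definition is_delta (k : nat) (d : G) (D delta : L -> L) : Prop :=
  linear delta /\
  forall (m : nat) (x : 'I_m -> {ffun 'I_n -> L}) (g : 'I_m -> 'I_n -> G),
    (forall i, homogeneous_family (grade A) (g i) (x i)) ->
    delta (\sum_(i < m) bracket A (x i)) =
      \sum_(i < m) \sum_(t < n) eps d (deg_before (g i) t) *:
        bracket A (subst_at (fun l => alphak k (x i l)) t (D (x i t))).

End Notions.

(* Main.v *)
(* Put E = D - delta. Perfectness turns the double derivation identity into a
   formula for D [x_1, ..., x_(n-1), w] with w arbitrary, in which D is applied
   to the x_i and delta to w; the definition of delta gives the same formula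
   for delta [x_1, ..., x_(n-1), w] with D applied to w. Subtracting yields (2)
   for the last slot, and skew-symmetry moves the slot to any position. Summing
   (2) over the n slots gives (3), and with (3) the double derivation identity
   for delta is a rearrangement of the one for D. *)
Require Import Defs.
From HB Require Import structures.
From mathcomp Require Import all_boot all_algebra all_fingroup.

Set Implicit Arguments.
Unset Strict Implicit.
Unset Printing Implicit Defensive.

Import GRing.Theory.
Local Open Scope ring_scope.

Local Notation append1 := (@append _ _.+1).

(** * Families with a distinguished last entry *)

Section Append.
Variables (T : Type) (m : nat).
Implicit Types (x : 'I_m -> T) (w u : T) (i : 'I_m).

Let widen i : 'I_m.+1 := widen_ord (leqnSn m) i.

Lemma append_widen x w i : append1 x w (widen i) = x i.
Proof.
rewrite ffunE; case: insubP => [j _ /= e|/=]; last by rewrite ltn_ord.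
by congr (x _); apply: val_inj.
Qed.

Lemma append_max x w : append1 x w ord_max = w.
Proof. by rewrite ffunE insubF //= ltnn. Qed.

Lemma ord_widen_maxP (P : 'I_m.+1 -> Prop) :
  (forall i, P (widen i)) -> P ord_max -> forall j, P j.
Proof.
move=> Pw Pm j; have [ltjm|] := ltnP j m.
  by have -> : j = widen (Ordinal ltjm) by apply: val_inj.
move=> lemj; suff -> : j = ord_max by [].
by apply: val_inj; apply/eqP; rewrite eqn_leq /= lemj -ltnS ltn_ord.
Qed.

Lemma widen_eq_max i : (widen i == ord_max) = false.
Proof. by rewrite -val_eqE /= ltn_eqF. Qed.

Lemma appendK (z : {ffun 'I_m.+1 -> T}) :
  append1 (fun i => z (widen i)) (z ord_max) = z.
Proof.
by apply/ffunP; apply: ord_widen_maxP => [i|]; rewrite ?append_widen ?append_max.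
Qed.

Lemma append_subst_max x (w u : T) :
  subst_at (append1 x w) ord_max u = append1 x u.
Proof.
apply/ffunP; apply: ord_widen_maxP => [i|]; rewrite ffunE ?eqxx ?append_max //.
by rewrite widen_eq_max !append_widen.
Qed.

Lemma map_append_subst_max (f : T -> T) x w u :
  subst_at (fun l => f (append1 x w l)) ord_max u =
  append1 (fun l => f (x l)) u.
Proof.
apply/ffunP; apply: ord_widen_maxP => [i|]; rewrite ffunE ?eqxx ?append_max //.
by rewrite widen_eq_max !append_widen.
Qed.

Lemma map_append_subst_widen (f : T -> T) x w i u :
  subst_at (fun l => f (append1 x w l)) (widen i) u =
  append1 (subst_at (fun l => f (x l)) i u) (f w).
Proof.
apply/ffunP; apply: ord_widen_maxP => [j|]; rewrite ffunE; last first.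
  by rewrite eq_sym widen_eq_max !append_max.
by rewrite !append_widen ffunE -!val_eqE.
Qed.

End Append.

(** * Degree sums preceding a slot *)

Section DegBefore.
Variables (G : zmodType) (m : nat).

Lemma deg_before_append_widen (g : 'I_m -> G) (h : G) (i : 'I_m) :
  deg_before (append1 g h) (widen_ord (leqnSn m) i) = deg_before g i.
Proof.
rewrite /deg_before big_mkcond big_ord_recr /= ltnNge ltnW //= addr0.
by rewrite [RHS]big_mkcond; apply: eq_bigr => j _; rewrite append_widen.
Qed.

Lemma deg_before_append_max (g : 'I_m -> G) (h : G) :
  deg_before (append1 g h) ord_max = \sum_i g i.
Proof.
rewrite /deg_before big_mkcond big_ord_recr /= ltnn addr0.
by apply: eq_bigr => j _; rewrite append_widen ltn_ord.
Qed.

(** After the swap, slot [i] carries the degree [g j] and the slots before [i] are untouched. This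
    computes the sign when a slot is moved one step to the right. *)
Lemma deg_before_tperm (g : 'I_m -> G) (i j : 'I_m) : val j = (val i).+1 ->
  deg_before (fun l => g (tperm i j l)) j = deg_before g i + g j.
Proof.
move=> /= eji; rewrite /deg_before (bigD1 i) /= ?eji ?ltnS // tpermL addrC.
congr (_ + _); apply: eq_big => [l|l /andP[]].
  by rewrite ltnS (ltn_neqAle l i) andbC.
rewrite ltnS => le_li ne_li; rewrite tpermD // eq_sym //.
by rewrite -val_eqE /= eji ltn_eqF.
Qed.

End DegBefore.

(** * Homogeneous components in a graded space *)

Section Grading.
Variables (K : fieldType) (G : zmodType) (L : lmodType K) (V : G -> {pred L}).
Hypothesis V_grading : grading V.

Lemma grade_sum g (I : Type) (s : seq I) (P : pred I) (F : I -> L) :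
  (forall i, P i -> F i \in V g) -> \sum_(i <- s | P i) F i \in V g.
Proof.
have [V_sub _ _] := V_grading; have [V0 VP] := V_sub g.
move=> VF; apply: (big_ind (fun v => v \in V g)) => // u v Vu Vv.
by have := VP 1 u v Vu Vv; rewrite scale1r.
Qed.

Lemma grade_scale g a v : v \in V g -> a *: v \in V g.
Proof.
have [V_sub _ _] := V_grading; have [V0 VP] := V_sub g.
by move=> Vv; have := VP a v 0 Vv V0; rewrite addr0.
Qed.

Lemma grade_sub g u v : u \in V g -> v \in V g -> u - v \in V g.
Proof.
have [V_sub _ _] := V_grading; have [V0 VP] := V_sub g.
by move=> Vu Vv; have := VP (-1) v u Vv Vu; rewrite scaleN1r addrC.
Qed.

(** The pairs in [s] are vectors tagged with a degree, and degrees may repeat. Grouping them by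
    degree, directness of the grading forces every group other than that of [g] to cancel. *)
Lemma grade_component g v (s : seq (G * L)) :
  v \in V g -> {in s, forall p, p.2 \in V p.1} -> v = \sum_(p <- s) p.2 ->
  v = \sum_(p <- s | p.1 == g) p.2.
Proof.
move=> Vv Vs vE; have [V_sub _ V_direct] := V_grading.
have V0 h : 0 \in V h by have [] := V_sub h.
pose t := undup (g :: map fst s).
(* [c h] is the degree [h] part of the sum minus that of [v]. The list [t] has no repetition and
   contains [g] and all degrees of [s], so directness applies once the [c h] sum to zero. *)
pose c h := \sum_(p <- s | p.1 == h) p.2 - (if h == g then v else 0).
have Vc h : c h \in V h.
  apply: grade_sub; last by case: eqP => [->|].
  rewrite big_seq_cond; apply: grade_sum => p /andP[ps /eqP <-]; exact: Vs.
have ut : uniq t by apply: undup_uniq.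
have tE F h : h \in t -> \sum_(l <- t | l == h) F l = F h :> L.
  by move=> ht; rewrite -big_filter filter_pred1_uniq // big_seq1.
have gt : g \in t by rewrite mem_undup mem_head.
have c0 : \sum_(h <- t) c h = 0.
  rewrite sumrB -big_mkcond tE // (exchange_big_dep predT) //=.
  apply/eqP; rewrite subr_eq0 vE big_seq [X in _ == X]big_seq; apply/eqP.
  apply: eq_bigr => p ps; under eq_bigl do rewrite eq_sym.
  by rewrite tE // mem_undup inE map_f ?orbT.
have /eqP := V_direct t c ut Vc c0 g gt.
by rewrite /c eqxx subr_eq0 => /eqP.
Qed.

End Grading.

(** * Multilinearity of the bracket and induction over brackets *)

Section Bracket.
Variables (K : fieldType) (G : zmodType) (eps : G -> G -> K) (m : nat).
Variables (L : lmodType K) (A : nHomLieColor eps m.+1 L).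
Implicit Types (x y : {ffun 'I_m.+1 -> L}) (g : 'I_m.+1 -> G).

Local Notation B := (bracket A).
Local Notation V := (grade A).

(** Named so that the bracket, as a function of one slot, can carry a linear structure;
    [bracket_last] does the same for an appended last slot. *)
Definition bracket_slot x i (w : L) : L := B (subst_at x i w).

HB.instance Definition _ x i :=
  GRing.isLinear.Build K L L _ (bracket_slot x i) (bracket_linear A x i).

Lemma bracket_slotE (x : 'I_m.+1 -> L) i w :
  B (subst_at x i w) = bracket_slot [ffun l => x l] i w.
Proof.
by congr (bracket A _); apply/ffunP => l; rewrite !ffunE; case: eqP.
Qed.

Lemma subst_id x i : subst_at x i (x i) = x.
Proof. by apply/ffunP => l; rewrite ffunE; case: eqP => [->|]. Qed.

Definition bracket_last (x : 'I_m -> L) (w : L) : L := B (append1 x w).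

Lemma bracket_last_linear (x : 'I_m -> L) : linear (bracket_last x).
Proof.
move=> a u v; have := bracket_linear A (append1 x 0) ord_max a u v.
by rewrite !append_subst_max.
Qed.

HB.instance Definition _ (x : 'I_m -> L) :=
  GRing.isLinear.Build K L L _ (bracket_last x) (bracket_last_linear x).

(** Perfectness gives sums of multiples of brackets. Multilinearity splits each slot into
    homogeneous components and absorbs scalars into a slot, so [P] need only be additive and hold on
    brackets of homogeneous vectors. *)
Lemma bracket_ind (P : L -> Prop) : perfect A ->
  P 0 -> (forall u v, P u -> P v -> P (u + v)) ->
  (forall x g, homogeneous_family V g x -> P (B x)) -> forall v, P v.
Proof.
move=> A_perfect P0 PD PB.
have Psum (I : Type) (s : seq I) (F : I -> L) :
    (forall i, P (F i)) -> P (\sum_(i <- s) F i).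
  by move=> PF; apply: (big_ind P).
(* Slots from [t] on are already homogeneous. The induction lowers [t] by expanding one more slot;
   at [t = 0] degrees can be chosen for all slots. *)
have Pbracket t x : (t <= m.+1)%N ->
    (forall i : 'I_m.+1, (t <= i)%N -> exists h, x i \in V h) -> P (B x).
  elim: t x => [|t IHt] x lt_tm x_hom.
    have [g xg] : exists g, homogeneous_family V g x.
      apply: (fin_all_exists (P := fun i h => x i \in V h)) => i; exact: x_hom.
    exact: PB xg.
  have [_ V_span _] := gradeP A; pose i := Ordinal lt_tm.
  have [s [c [Vc xE]]] := V_span (x i).
  rewrite -(subst_id x i) -/(bracket_slot x i (x i)) xE linear_sum.
  apply: Psum => h; apply: IHt => [|j le_tj]; first exact: ltnW.
  rewrite ffunE; case: eqP => [_|/eqP ne_ji]; first by exists h.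
  by apply: x_hom; rewrite ltn_neqAle le_tj andbT eq_sym.
(* [derived] is closed under scaling, so P is strengthened to all multiples. *)
move=> v; rewrite -[v]scale1r; move: 1; elim: (A_perfect v) => {v}.
- move=> x a; rewrite -(subst_id x ord0) -/(bracket_slot x ord0 _) -linearZ.
  by apply: (Pbracket m.+1) => // j; rewrite leqNgt ltn_ord.
- by move=> a; rewrite scaler0.
- by move=> u v _ IHu _ IHv a; rewrite scalerDr; apply: PD.
- by move=> b u _ IHu a; rewrite scalerA.
Qed.

(** * Powers of the twisting map *)

Section AlphaK.
Variable k : nat.

Lemma alphak_linear : linear (alphak A k).
Proof. by move=> a u v; elim: k => //= j ->; rewrite linearP. Qed.

HB.instance Definition _ :=
  GRing.isLinear.Build K L L _ (alphak A k) alphak_linear.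

Lemma alphak_grade h v : v \in V h -> alphak A k v \in V h.
Proof. by move=> Vv; elim: k => //= j IHj; apply: alpha_even. Qed.

Lemma alphak_alpha v : alphak A k (alpha A v) = alpha A (alphak A k v).
Proof. by rewrite /alphak -iterSr. Qed.

Lemma alphak_bracket x : is_multiplicative A ->
  alphak A k (B x) = B [ffun l => alphak A k (x l)].
Proof.
move=> A_mult; rewrite /alphak; elim: k => /= [|j ->].
  by congr (bracket A _); apply/ffunP => l; rewrite ffunE.
by rewrite A_mult; congr (bracket A _); apply/ffunP => l; rewrite !ffunE.
Qed.

End AlphaK.

(** * Leibniz sums and their signs *)

Section Leibniz.
Hypothesis eps_bichar : bicharacter eps.
Hypotheses (A_perfect : perfect A) (A_mult : is_multiplicative A).
Variables (k : nat) (d : G).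
Local Notation ak := (alphak A k).

(** The value that defines [delta_f] on a single bracket. *)
Definition leibniz_sum (f : L -> L) (x : 'I_m.+1 -> L) g : L :=
  \sum_t eps d (deg_before g t) *: B (subst_at (fun l => ak (x l)) t (f (x t))).

(** The part of the Leibniz sum of [(x, w)] where [f] hits an entry of [x]. Its signs involve only
    degrees of [x], so [w] may be inhomogeneous. *)
Definition leibniz_init (f : L -> L) (x : 'I_m -> L) (g : 'I_m -> G) (w : L) :=
  \sum_i eps d (deg_before g i) *:
    bracket_last (subst_at (fun l => ak (x l)) i (f (x i))) (ak w).

Lemma leibniz_sumB (f1 f2 : L -> L) x g :
  leibniz_sum (fun v => f1 v - f2 v) x g =
  leibniz_sum f1 x g - leibniz_sum f2 x g.
Proof.
rewrite /leibniz_sum -sumrB; apply: eq_bigr => t _.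
by rewrite !bracket_slotE linearB scalerBr.
Qed.

Lemma leibniz_sum_append f (x : 'I_m -> L) w (g : 'I_m -> G) h :
  leibniz_sum f (append1 x w) (append1 g h) =
  leibniz_init f x g w
  + eps d (\sum_i g i) *: bracket_last (fun l => ak (x l)) (f w).
Proof.
rewrite /leibniz_sum big_ord_recr /= deg_before_append_max append_max.
rewrite map_append_subst_max; congr (_ + _).
apply: eq_bigr => i _; rewrite deg_before_append_widen append_widen.
by rewrite map_append_subst_widen.
Qed.

(** Recognises the second sum of the double derivation identity, with [h] the total degree of the
    outer arguments, as one Leibniz sum inside the last slot. *)
Lemma bracket_last_leibniz_sum f (x : 'I_m -> L) (h : G) y g :
  \sum_j eps d (h + deg_before g j) *:
    B (append1 x (B (subst_at (fun l => ak (y l)) j (f (y j))))) =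
  eps d h *: bracket_last x (leibniz_sum f y g).
Proof.
have [_ _ _ epsDr] := eps_bichar.
rewrite /leibniz_sum linear_sum scaler_sumr; apply: eq_bigr => j _.
by rewrite epsDr linearZ /= scalerA.
Qed.

Lemma homogeneous_append (x : 'I_m -> L) w (g : 'I_m -> G) h :
  homogeneous_family V g x -> w \in V h ->
  homogeneous_family V (append1 g h) (append1 x w).
Proof.
move=> xg wh; apply: ord_widen_maxP => [i|]; last by rewrite !append_max.
by rewrite !append_widen.
Qed.

Lemma homogeneous_subst f x g t :
  (forall h v, v \in V h -> f v \in V (h + d)) -> homogeneous_family V g x ->
  homogeneous_family V (fun l => if l == t then g t + d else g l)
    (subst_at (fun l => ak (x l)) t (f (x t))).
Proof.
move=> f_deg xg l; rewrite ffunE; case: eqP => _; first exact: f_deg.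
exact: alphak_grade.
Qed.

Lemma sum_deg_subst g t :
  \sum_l (if l == t then g t + d else g l) = \sum_l g l + d.
Proof.
rewrite (bigD1 t) //= eqxx [in RHS](bigD1 t) //= addrAC; congr (_ + _ + _).
by apply: eq_bigr => l /negbTE ->.
Qed.

Lemma leibniz_sum_grade f x g :
  (forall h v, v \in V h -> f v \in V (h + d)) -> homogeneous_family V g x ->
  leibniz_sum f x g \in V (\sum_l g l + d).
Proof.
move=> f_deg xg; apply: (grade_sum (gradeP A)) => t _.
apply: (grade_scale (gradeP A)); rewrite -(sum_deg_subst g t).
exact: bracket_grade (homogeneous_subst _ f_deg xg).
Qed.

(** Swap slots [i] and [i+1], use the formula at slot [i+1], and swap back. The signs match because
    [eps] is multiplicative in both arguments. *)
Lemma last_slot_any_slot (E : {linear L -> L}) :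
  (forall h v, v \in V h -> E v \in V (h + d)) ->
  (forall x g, homogeneous_family V g x -> E (B x) =
     - (eps d (deg_before g ord_max) *:
        B (subst_at (fun l => ak (x l)) ord_max (E (x ord_max))))) ->
  forall x g i, homogeneous_family V g x -> E (B x) =
     - (eps d (deg_before g i) *: B (subst_at (fun l => ak (x l)) i (E (x i)))).
Proof.
have [_ _ epsDl epsDr] := eps_bichar.
(* Induction on the distance from slot [i] to the last slot. *)
move=> E_deg E_last x g i; have [r ri] := ubnP (m - i).
elim: r => // r IHr in x g i ri *; move=> xg.
have [lt_im|le_mi] := ltnP i m; last first.
  have -> : i = ord_max.
    by apply: val_inj; apply/eqP; rewrite eqn_leq /= le_mi -ltnS ltn_ord.
  exact: (E_last x g xg).
have lt_jm : (i.+1 < m.+1)%N by [].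
pose j := Ordinal lt_jm; have eji : val j = (val i).+1 by [].
have ne_ji : j != i by rewrite -val_eqE /= gtn_eqF.
pose x' := [ffun l => x (tperm i j l)]; pose g' l := g (tperm i j l).
have x'g' : homogeneous_family V g' x' by move=> l; rewrite ffunE.
have lt_r : (m - j < r)%N.
  by rewrite -ltnS (leq_trans _ ri) // ltnS /= subnSK.
rewrite (bracket_skew xg eji) -/x' linearN linearZ /=.
rewrite (IHr x' g' j lt_r x'g') deg_before_tperm //.
(* Slot [i] now holds [E (x i)], of degree [g i + d], so swapping back costs
   [eps (g i + d) (g j)]. *)
rewrite (bracket_skew (homogeneous_subst i E_deg xg) eji) eqxx (negbTE ne_ji).
have -> : [ffun l => subst_at (fun l => ak (x l)) i (E (x i)) (tperm i j l)] =
          subst_at (fun l => ak (x' l)) j (E (x' j)).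
  apply/ffunP => l; rewrite !ffunE tpermR.
  by rewrite -[X in _ == X](tpermR i j) (inj_eq perm_inj).
rewrite !scalerN !scalerA epsDl epsDr; congr (- - (_ *: _)).
by rewrite mulrCA mulrA.
Qed.

(** * The map [delta] and its difference from [D] *)

Section Delta.
Variables D delta : {linear L -> L}.
Hypothesis D_deg : forall h v, v \in V h -> D v \in V (h + d).
Hypothesis D_alpha : forall v, D (alpha A v) = alpha A (D v).
Hypothesis D_double : forall (x : 'I_m -> L) (gx : 'I_m -> G) y gy,
  homogeneous_family V gx x -> homogeneous_family V gy y ->
  D (bracket_last x (B y)) =
    leibniz_init D x gx (B y)
    + eps d (\sum_i gx i) *:
        bracket_last (fun l => ak (x l)) (leibniz_sum D y gy).
Hypothesis deltaE : forall x g, homogeneous_family V g x ->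
  delta (B x) = leibniz_sum D x g.

(** On a bracket of homogeneous vectors the degree is read off the Leibniz sum. A homogeneous [v]
    may be a sum of such brackets of various degrees, but those of degree other than [h] can be
    discarded. *)
Lemma delta_deg h v : v \in V h -> delta v \in V (h + d).
Proof.
pose Q v := exists2 s : seq (G * L), v = \sum_(p <- s) p.2 &
  {in s, forall p, p.2 \in V p.1 /\ delta p.2 \in V (p.1 + d)}.
have [s vE Vs] : Q v.
  apply: bracket_ind v => //.
  - by exists [::] => //; rewrite big_nil.
  - move=> u v [s1 -> Q1] [s2 -> Q2]; exists (s1 ++ s2); rewrite ?big_cat //.
    by move=> p; rewrite mem_cat => /orP[/Q1|/Q2].
  - move=> x g xg; exists [:: (\sum_l g l, B x)]; first by rewrite big_seq1.
    move=> p; rewrite inE => /eqP -> /=; split; first exact: bracket_grade.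
    by rewrite (deltaE xg); apply: leibniz_sum_grade.
move=> Vv; rewrite (grade_component (gradeP A) Vv _ vE); last by move=> p /Vs[].
rewrite linear_sum big_seq_cond; apply: (grade_sum (gradeP A)).
by move=> p /andP[/Vs[_ Vp] /eqP <-].
Qed.

Lemma delta_alpha v : delta (alpha A v) = alpha A (delta v).
Proof.
move: v; apply: (bracket_ind A_perfect) => [|u v IHu IHv|x g xg].
- by rewrite !linear0.
- by rewrite !linearD IHu IHv.
have axg : homogeneous_family V g [ffun l => alpha A (x l)].
  by move=> l; rewrite ffunE; apply: alpha_even.
rewrite A_mult (deltaE axg) (deltaE xg) linear_sum; apply: eq_bigr => t _.
rewrite linearZ /= A_mult; congr (_ *: bracket A _); apply/ffunP => l.
by rewrite !ffunE; case: eqP => _; rewrite ?alphak_alpha ?D_alpha.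
Qed.

(** For [w] a bracket this is the double derivation identity, whose inner Leibniz sum is [delta w].
    Both sides are linear in [w], so induction over brackets gives every [w]. *)
Lemma D_bracket_last (x : 'I_m -> L) (g : 'I_m -> G) w :
  homogeneous_family V g x ->
  D (bracket_last x w) =
    leibniz_init D x g w
    + eps d (\sum_i g i) *: bracket_last (fun l => ak (x l)) (delta w).
Proof.
move=> xg; move: w; apply: (bracket_ind A_perfect) => [|u v IHu IHv|y gy ygy].
- rewrite !linear0 addr0 /leibniz_init big1 // => i _.
  by rewrite !linear0.
- rewrite !linearD IHu IHv addrACA; congr (_ + _).
  rewrite -big_split; apply: eq_bigr => i _ /=.
  by rewrite !linearD.
- by rewrite (D_double xg ygy) (deltaE ygy).
Qed.

Definition defect (v : L) : L := D v - delta v.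

Lemma defect_linear : linear defect.
Proof.
move=> a u v; rewrite /defect (linearP D) (linearP delta) /=.
by rewrite scalerBr opprD addrACA.
Qed.

HB.instance Definition _ :=
  GRing.isLinear.Build K L L _ defect defect_linear.

Lemma defect_bracket x g i : homogeneous_family V g x ->
  defect (B x) =
    - (eps d (deg_before g i) *:
       B (subst_at (fun l => ak (x l)) i (defect (x i)))).
Proof.
apply: (last_slot_any_slot (E := defect)) => {x g i} [h v Vv|x g xg].
  by apply: (grade_sub (gradeP A)); [apply: D_deg | apply: delta_deg].
pose x' i := x (widen_ord (leqnSn m) i); pose g' i := g (widen_ord (leqnSn m) i).
have x'g' : homogeneous_family V g' x' by move=> i; apply: xg.
have eg : deg_before g ord_max = \sum_i g' i.
  rewrite /deg_before big_mkcond big_ord_recr /= ltnn addr0.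
  by apply: eq_bigr => i _; rewrite ltn_ord.
have xE : append1 x' (x ord_max) = x by rewrite appendK.
have substE w : B (subst_at (fun l => ak (x l)) ord_max w) =
    bracket_last (fun l => ak (x' l)) w.
  by rewrite /bracket_last -(map_append_subst_max ak x' (x ord_max)) xE.
(* [DxE] and [dxE] share their [leibniz_init] term and differ in the last slot, holding
   [delta (x ord_max)] and [D (x ord_max)] respectively; the reversed order gives the minus sign. *)
have DxE := D_bracket_last (x ord_max) x'g'.
rewrite [X in D X]/bracket_last xE in DxE.
have := deltaE (homogeneous_append x'g' (xg ord_max)).
rewrite leibniz_sum_append xE => dxE.
rewrite substE eg /= /defect DxE dxE opprD addrACA subrr add0r.
by rewrite linearB scalerBr opprB.
Qed.

(** By [defect_bracket], each of the [m.+1] summands equals [- defect (B x)]. *)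
Lemma leibniz_sum_defect x g : homogeneous_family V g x ->
  leibniz_sum defect x g = - (defect (B x) *+ m.+1).
Proof.
move=> xg; transitivity (\sum_(t < m.+1) - defect (B x)); last first.
  by rewrite sumr_const card_ord mulNrn.
by apply: eq_bigr => t _; rewrite (defect_bracket t xg) opprK.
Qed.

Lemma delta_defect (dE : {linear L -> L}) :
  (forall x g, homogeneous_family V g x -> dE (B x) = leibniz_sum defect x g) ->
  forall v, dE v = - (defect v *+ m.+1).
Proof.
move=> dEE; apply: (bracket_ind A_perfect) => [|u v IHu IHv|x g xg].
- by rewrite !linear0 mul0rn oppr0.
- by rewrite (linearD dE) IHu IHv -opprD -mulrnDl -(linearD defect).
- by rewrite (dEE x g xg) leibniz_sum_defect.
Qed.

(** Apply [leibniz_sum_defect] to the family [(x, w)] and solve for [delta] of its bracket. The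
    correction [- n] times the defect moves into the last slot by [defect_last], where it turns
    [delta w] into the Leibniz sum of [delta] over [y]. *)
Lemma delta_double (x : 'I_m -> L) (gx : 'I_m -> G) y gy :
  homogeneous_family V gx x -> homogeneous_family V gy y ->
  delta (bracket_last x (B y)) =
    leibniz_init delta x gx (B y)
    + eps d (\sum_i gx i) *:
        bracket_last (fun l => ak (x l)) (leibniz_sum delta y gy).
Proof.
move=> xg yg; set w := B y; set X := \sum_i _; set ax := fun l => _.
have xwg := homogeneous_append xg (bracket_grade yg : w \in _).
have defect_last : eps d X *: bracket_last ax (defect w) =
    - defect (bracket_last x w).
  rewrite [bracket_last x w]/bracket_last (defect_bracket ord_max xwg).
  by rewrite deg_before_append_max map_append_subst_max append_max opprK.
(* Over [y], the Leibniz sum of [D] is [delta w] and that of the defect is [- (defect w *+ m.+1)];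
   subtract. *)
have sum_delta : leibniz_sum delta y gy = delta w + defect w *+ m.+1.
  have := leibniz_sum_defect yg; rewrite leibniz_sumB -(deltaE yg) -/w.
  by move=> e; rewrite -[defect w *+ _]opprK -e opprB addrC subrK.
have := leibniz_sum_defect xwg.
rewrite leibniz_sumB -(deltaE xwg) leibniz_sum_append -/X -/ax.
rewrite sum_delta -/(bracket_last x w) => /(canRL (subrK _)) ->.
rewrite addrC -addrA; congr (_ + _).
rewrite [bracket_last ax (_ + _)]linearD scalerDr /=.
by rewrite [bracket_last ax (_ *+ _)]linearMn -scalerMnr defect_last mulNrn.
Qed.

End Delta.
End Leibniz.
End Bracket.

(** * Transfer of the results to the maps given by the hypotheses *)

Theorem proposition3 (K : fieldType) (G : zmodType) (eps : G -> G -> K)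
    (heps : bicharacter eps) (n : nat) (hn : (3 <= n)%N) (L : lmodType K)
    (A : nHomLieColor eps n L)
    (hcenter : centerless A) (hperfect : perfect A) (hmult : is_multiplicative A)
    (k : nat) (d : G) (D : L -> L) (hD : double_derivation A k d D)
    (delta : L -> L) (hdelta : is_delta A k d D delta) :
  [/\ double_derivation A k d delta,
      forall (x : {ffun 'I_n -> L}) (g : 'I_n -> G) (i : 'I_n),
        homogeneous_family (grade A) g x ->
        D (bracket A x) - delta (bracket A x) =
          - (eps d (deg_before g i) *:
               bracket A (subst_at (fun l => alphak A k (x l)) i
                                   (D (x i) - delta (x i))))
    & forall deltaE : L -> L,
        is_delta A k d (fun v => D v - delta v) deltaE <->
        (forall v, deltaE v = - ((D v - delta v) *+ n))].
Proof.
case: n hn A hcenter hperfect hmult hD hdelta => // m _ A _ hperfect hmult.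
case=> D_lin D_deg D_alpha D_double [delta_lin delta_sum].
have is_delta_bracket (f df : L -> L) (x : {ffun 'I_m.+1 -> L}) g :
    is_delta A k d f df -> homogeneous_family (grade A) g x ->
    df (bracket A x) = leibniz_sum A k d f x g.
  move=> [_ df_sum] xg; have := df_sum 1%N (fun=> x) (fun=> g) (fun=> xg).
  by rewrite !big_ord1.
have delta_bracket (x : {ffun 'I_m.+1 -> L}) g :=
  is_delta_bracket D delta x g (conj delta_lin delta_sum).
pose fD : {linear L -> L} := HB.pack D (GRing.isLinear.Build K L L _ D D_lin).
pose fd : {linear L -> L} :=
  HB.pack delta (GRing.isLinear.Build K L L _ delta delta_lin).
have double (x : 'I_m -> L) (gx : 'I_m -> G) (y : {ffun 'I_m.+1 -> L}) gy :
    homogeneous_family (grade A) gx x -> homogeneous_family (grade A) gy y ->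
    fD (bracket_last A x (bracket A y)) =
    leibniz_init A k d fD x gx (bracket A y) + eps d (\sum_i gx i) *:
      bracket_last A (fun l => alphak A k (x l)) (leibniz_sum A k d fD y gy).
  move=> xg yg; rewrite -bracket_last_leibniz_sum //.
  (* Multiplicativity identifies [alphak] of the inner bracket with the bracket of the
     [alphak (y l)]. *)
  rewrite /leibniz_init alphak_bracket //; exact: D_double.
have E_bracket := defect_bracket (D := fD) (delta := fd) heps hperfect
  D_deg double delta_bracket.
have E_sum := leibniz_sum_defect (D := fD) (delta := fd) heps hperfect
  D_deg double delta_bracket.
split; first split => //.
- exact: (delta_deg (D := fD) (delta := fd) hperfect D_deg delta_bracket).
- exact: (delta_alpha (D := fD) (delta := fd) hperfect hmult D_alpha
    delta_bracket).
- move=> x gx y gy xg yg; rewrite bracket_last_leibniz_sum // -alphak_bracket //.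
  exact: (delta_double (D := fD) (delta := fd) heps hperfect D_deg double
    delta_bracket).
- by move=> x g i xg; apply: E_bracket.
pose fF : {linear L -> L} := defect fD fd.
move=> deltaE; split=> [hE v | hE].
  have [E_lin _] := hE.
  pose fE : {linear L -> L} :=
    HB.pack deltaE (GRing.isLinear.Build K L L _ deltaE E_lin).
  apply: (delta_defect (D := fD) (delta := fd) (dE := fE) heps hperfect
    D_deg double delta_bracket) => x g xg.
  exact: is_delta_bracket.
(* Conversely, [- n] times the defect is linear and takes the required value on every finite sum of
   brackets, so the map attached to [D - delta] exists. *)
have {}hE v : deltaE v = - (fF v *+ m.+1) by exact: hE.
split=> [a u v|r x g xg].
  by rewrite !hE (linearP fF) mulrnDl opprD scalerMnr scalerN.
rewrite hE (linear_sum fF) -sumrMnl -sumrN; apply: eq_bigr => i _.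
by rewrite -(E_sum _ _ (xg i)).
Qed.
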